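(* Let $L\ge 3$, let $\Lambda=(\mathbb{Z}/L\mathbb{Z})^2$ be the finite two-dimensional square lattice with periodic boundary conditions, and let $\mathcal{G}=(\Lambda,e)$ be the graph whose edges join nearest-neighbouring sites. Let $\theta=\{w_{ij},a_i,b_i\}$ be real coupling constants, with one $w_{ij}=w_{ji}$ for each edge $\langle ij\rangle\in e$ and one pair $a_i,b_i$ for each site $i\in\Lambda$, and let $$S(\phi;\theta)=-\sum_{\langle ij\rangle} w_{ij}\phi_i\phi_j+\sum_{i} a_i\phi_i^2+\sum_i b_i\phi_i^4,\qquad \phi=(\phi_i)_{i\in\Lambda}\in\mathbb{R}^\Lambda .$$ Assume that $Z=\int_{\mathbb{R}^\Lambda}\exp[-S(\bm{\phi};\theta)]\,d\bm{\phi}<\infty$. Then the probability distribution on $\mathbb{R}^\Lambda$ with density $$p(\phi;\theta)=\frac{\exp[-S(\phi;\theta)]}{\int_{\mathbb{R}^\Lambda}\exp[-S(\bm{\phi};\theta)]\,d\bm{\phi}}$$ satisfies the local Markov property with respect to $\mathcal{G}$: for every $i\in\Lambda$, $$p\big(\phi_i\mid(\phi_j)_{j\in\Lambda\setminus\{i\}}\big)=p\big(\phi_i\mid(\phi_j)_{j\in\mathcal{N}_i}\big)$$ for Lebesgue-almost every $\phi\in\mathbb{R}^\Lambda$, where $\mathcal{N}_i$ is the set of neighbours of $i$ in $\mathcal{G}$. That is, the (inhomogeneous) $\phi^4$ lattice scalar field theory on the square lattice is a Markov random field.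
   Context: The sum $\sum_{\langle ij\rangle}$ runs over the (unordered) edges of $\mathcal{G}$, i.e. each nearest-neighbour pair is counted once, and $\sum_i$ runs over all sites $i\in\Lambda$. Two vertices are neighbours if they are connected by an edge. To each vertex $i$ is assigned a real-valued random variable $\phi_i$, and $d\bm{\phi}$ is Lebesgue measure on $\mathbb{R}^\Lambda$. For $A\subseteq\Lambda\setminus\{i\}$, $p(\phi_i\mid(\phi_j)_{j\in A})$ denotes the conditional density of $\phi_i$ given $(\phi_j)_{j\in A}$, i.e. the marginal density of $(\phi_j)_{j\in A\cup\{i\}}$ divided by the marginal density of $(\phi_j)_{j\in A}$. A Markov random field on a graph is a family of random variables indexed by its vertices whose joint probability distribution satisfies the local Markov property with respect to that graph. The standard homogeneous two-dimensional $\phi^4$ Euclidean lattice action $S_E=-\kappa_L\sum_{\langle ij\rangle}\phi_i\phi_j+\frac{\mu_L^2+4\kappa_L}{2}\sum_i\phi_i^2+\frac{\lambda_L}{4}\sum_i\phi_i^4$, with dimensionless parameters $\kappa_L,\mu_L^2,\lambda_L$, is the special case $w_{ij}=\kappa_L$, $a_i=(\mu_L^2+4\kappa_L)/2$, $b_i=\lambda_L/4$. *)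

(* Defs.v *)
From HB Require Import structures.
From mathcomp Require Import all_boot all_order all_algebra.
From mathcomp Require Import all_classical all_reals all_analysis.

Set Implicit Arguments.
Unset Strict Implicit.
Unset Printing Implicit Defensive.
Import Order.TTheory GRing.Theory Num.Theory.
Import numFieldNormedType.Exports.

Local Open Scope classical_set_scope.
Local Open Scope ring_scope.

(* The product sigma-algebra on {ffun I -> T}, generated by the coordinates.  *)

Definition measure_ffun_display : measure_display -> measure_display.
Proof. exact. Qed.

Section measurable_ffun.
Context {d} {T : measurableType d} {I : finType}.

HB.instance Definition _ := isPointed.Build {ffun I -> T} [ffun=> point].

Definition ffun_cylinders : set (set {ffun I -> T}) :=
  \bigcup_(i in [set: I])
    preimage_set_system setT (fun f : {ffun I -> T} => f i) measurable.

Let ffun_set0 : <<s ffun_cylinders >> set0.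
Proof. exact: sigma_algebra0. Qed.

Let ffun_setC A : <<s ffun_cylinders >> A -> <<s ffun_cylinders >> (~` A).
Proof. exact: sigma_algebraC. Qed.

Let ffun_bigcup (F : _^nat) : (forall i, <<s ffun_cylinders >> (F i)) ->
  <<s ffun_cylinders >> (\bigcup_i F i).
Proof. exact: sigma_algebra_bigcup. Qed.

HB.instance Definition _ := @isMeasurable.Build (measure_ffun_display d)
  {ffun I -> T} <<s ffun_cylinders >> ffun_set0 ffun_setC ffun_bigcup.

End measurable_ffun.

Section ffun_measurability.
Context {d} {T : measurableType d} {I : finType}.

Lemma measurable_ffun_eval (i : I) :
  measurable_fun [set: {ffun I -> T}] (fun f => f i).
Proof.
move=> _ Y mY; rewrite setTI; apply: sub_sigma_algebra.
by exists i => //; exists Y => //; rewrite setTI.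
Qed.

Lemma measurable_to_ffun d' (T' : measurableType d') (g : T' -> {ffun I -> T}) :
  (forall i, measurable_fun [set: T'] (fun x => g x i)) ->
  measurable_fun [set: T'] g.
Proof.
move=> mg; apply: (@measurability _ _ _ _ _ _ ffun_cylinders) => //.
move=> _ [_ [i _ [Y mY <-]] <-]; rewrite !setTI -comp_preimage.
by rewrite -[X in measurable X]setTI; exact: mg.
Qed.

End ffun_measurability.

(* The image of a sigma-finite measure by a measurable map with a measurable
   left inverse, bundled as a sigma-finite measure.                           *)
Section pushforward_sigma_finite.
Local Open Scope ereal_scope.
Context d d' (T : measurableType d) (T' : measurableType d') (R : realType).
Variables (m : {measure set T -> \bar R}) (f : T -> T') (g : T' -> T).

Definition pushforward_can of sigma_finite setT m & measurable_fun setT f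
  & measurable_fun setT g & cancel f g := pushforward m f.

Hypotheses (sm : sigma_finite setT m) (mf : measurable_fun setT f).
Hypotheses (mg : measurable_fun setT g) (fK : cancel f g).
Local Notation pf := (pushforward_can sm mf mg fK).

Let pf0 : pf set0 = 0.
Proof. by rewrite /pushforward_can /pushforward preimage_set0 measure0. Qed.

Let pf_ge0 A : 0 <= pf A.
Proof. exact: measure_ge0. Qed.

Let pf_sigma_additive : semi_sigma_additive pf.
Proof.
move=> F mF tF mUF; rewrite /pushforward_can /pushforward preimage_bigcup.
apply: measure_semi_sigma_additive.
- by move=> n; rewrite -[X in measurable X]setTI; exact: mf.
- apply/trivIsetP => /= i j _ _ ij; rewrite -preimage_setI.
  by move/trivIsetP : tF => /(_ _ _ _ _ ij) ->//; rewrite preimage_set0.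
- by rewrite -preimage_bigcup -[X in measurable X]setTI; exact: mf.
Qed.

HB.instance Definition _ := isMeasure.Build _ _ _ pf pf0 pf_ge0
  pf_sigma_additive.

Let pf_sigma_finite : sigma_finite setT pf.
Proof.
have [F FT /all_and2[mF Foo]] := sm.
exists (fun n => g @^-1` F n).
  by rewrite -preimage_bigcup -FT preimage_setT.
move=> n; split; first by rewrite -[X in measurable X]setTI; exact: mg.
rewrite /pushforward_can /pushforward.
have -> : f @^-1` (g @^-1` F n) = F n.
  by apply/seteqP; split=> x; rewrite /preimage/= fK.
exact: Foo.
Qed.

HB.instance Definition _ := @Measure_isSigmaFinite.Build _ _ _ pf
  pf_sigma_finite.

End pushforward_sigma_finite.

Lemma sigma_finite_product_measure1 d1 d2 (T1 : measurableType d1)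
    (T2 : measurableType d2) (R : realType)
    (m1 : {sigma_finite_measure set T1 -> \bar R})
    (m2 : {sigma_finite_measure set T2 -> \bar R}) :
  sigma_finite setT (m1 \x m2)%E.
Proof.
have /sigma_finiteP[F [TF ndF Foo]] := sigma_finiteT m1.
have /sigma_finiteP[G [TG ndG Goo]] := sigma_finiteT m2.
exists (fun n => F n `*` G n).
  rewrite -setXTT TF TG predeqE => -[x y]; split.
    move=> [/= [n _ Fnx] [k _ Gky]]; exists (maxn n k) => //; split.
    - by move: x Fnx; exact/subsetPset/ndF/leq_maxl.
    - by move: y Gky; exact/subsetPset/ndG/leq_maxr.
  by move=> [n _ []/= ? ?]; split; exists n.
move=> k; have [? ?] := Foo k; have [? ?] := Goo k.
split; first exact: measurableX.
by rewrite product_measure1E// lte_mul_pinfty// ge0_fin_numE.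
Qed.

(* Lebesgue measure on n.-tuple R: the n-fold product of lebesgue_measure,
   along the identification of R * R^n with R^(n+1).                          *)
Section lebesgue_tuple.
Context {R : realType}.

Definition tuple_cons n (x : measurableTypeR R * n.-tuple R) : n.+1.-tuple R :=
  [tuple of (x.1 : R) :: x.2].

Definition tuple_uncons n (t : n.+1.-tuple R) :
    measurableTypeR R * n.-tuple R :=
  (thead t, [tuple of behead t]).

Lemma tuple_consK n : cancel (@tuple_cons n) (@tuple_uncons n).
Proof. by move=> [x t]; congr pair; apply/val_inj. Qed.

Lemma measurable_tuple_cons n : measurable_fun setT (@tuple_cons n).
Proof. by apply: measurable_cons. Qed.

Lemma measurable_tuple_uncons n : measurable_fun setT (@tuple_uncons n).
Proof.
apply/measurable_fun_pair; last exact: measurable_behead.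
exact: measurable_tnth.
Qed.

Definition lebesgue_tuple_cons n
    (m : {sigma_finite_measure set (n.-tuple R) -> \bar R}) :
    {sigma_finite_measure set (n.+1.-tuple R) -> \bar R} :=
  pushforward_can (sigma_finite_product_measure1 lebesgue_measure m)
    (@measurable_tuple_cons n) (@measurable_tuple_uncons n) (@tuple_consK n).

Fixpoint lebesgue_tuple n : {sigma_finite_measure set (n.-tuple R) -> \bar R} :=
  if n is n'.+1 then lebesgue_tuple_cons (lebesgue_tuple n')
  else @dirac _ _ [tuple] R.

End lebesgue_tuple.

(* Lebesgue measure on {ffun I -> R}, transported from #|I|.-tuple R along the
   enumeration of I.                                                          *)
Section lebesgue_ffun.
Context {R : realType} (I : finType).

Definition ffun_of_tuple (t : #|I|.-tuple R) : {ffun I -> R} :=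
  [ffun i => tnth t (enum_rank i)].

Definition tuple_of_ffun (f : {ffun I -> R}) : #|I|.-tuple R :=
  [tuple f (enum_val k) | k < #|I|].

Lemma ffun_of_tupleK : cancel ffun_of_tuple tuple_of_ffun.
Proof.
by move=> t; apply: eq_from_tnth => k; rewrite tnth_mktuple ffunE enum_valK.
Qed.

Lemma measurable_ffun_of_tuple : measurable_fun setT ffun_of_tuple.
Proof.
apply: measurable_to_ffun => i.
under eq_fun do rewrite ffunE.
exact: measurable_tnth.
Qed.

Lemma measurable_tuple_of_ffun : measurable_fun setT tuple_of_ffun.
Proof.
apply/measurable_fun_tnthP => k; rewrite /comp.
under eq_fun do rewrite tnth_mktuple.
exact: measurable_ffun_eval.
Qed.

Definition lebesgue_ffun : {sigma_finite_measure set {ffun I -> R} -> \bar R} :=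
  pushforward_can (sigma_finiteT (lebesgue_tuple #|I|))
    measurable_ffun_of_tuple measurable_tuple_of_ffun ffun_of_tupleK.

End lebesgue_ffun.

Section lebesgue_box.
Local Open Scope ereal_scope.
Context {R : realType}.

Lemma lebesgue_tuple_box n (B : 'I_n -> set R) :
  (forall k, measurable (B k)) ->
  lebesgue_tuple n [set t | forall k, B k (tnth t k)] =
  \big[*%E/1]_(k < n) lebesgue_measure (B k).
Proof.
elim: n B => [|n IHn] B mB.
  by rewrite big_ord0 /= diracE mem_set// => -[].
rewrite big_ord_recl /= -IHn => [|k]; last exact: mB.
rewrite /pushforward_can /pushforward -product_measure1E.
- congr (product_measure1 _ _ _); apply/seteqP; split => -[x t] /=.
    by move=> H; split=> [|k]; [have := H ord0 | have := H (lift ord0 k); rewrite tnthS].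
  move=> [Bx Bt] k; case: (unliftP ord0 k) => [j ->|-> //].
  by rewrite tnthS; exact: Bt.
- exact: mB.
- rewrite (_ : [set t | _] = \bigcap_(k in [set: 'I_n])
      ((fun t : n.-tuple R => tnth t k) @^-1` B (lift ord0 k))).
    apply: fin_bigcap_measurable => // k _.
    by rewrite -[X in measurable X]setTI; apply: measurable_tnth.
  by apply/seteqP; split=> [t Ht k _|t Ht k]; [exact: Ht | exact: Ht].
Qed.

(* The characteristic property of Lebesgue measure on R^I. *)
Lemma lebesgue_ffun_box (I : finType) (B : I -> set R) :
  (forall i, measurable (B i)) ->
  lebesgue_ffun I [set f | forall i, B i (f i)] =
  \big[*%E/1]_i lebesgue_measure (B i).
Proof.
move=> mB; rewrite [RHS](reindex (fun k : 'I_#|I| => enum_val k))/=;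
  last exact/onW_bij/enum_val_bij.
rewrite -lebesgue_tuple_box => [|k]; last exact: mB.
rewrite /pushforward_can /pushforward; congr (lebesgue_tuple _ _).
apply/seteqP; split=> t /= Bt k.
  by have := Bt (enum_val k); rewrite ffunE enum_valK.
by rewrite ffunE; have := Bt (enum_rank k); rewrite enum_rankK.
Qed.

End lebesgue_box.

Section density.
Context {R : realType} (V : finType).
Implicit Types (p : {ffun V -> R} -> R) (A : {set V}) (phi : {ffun V -> R}).

Definition probability_density p :=
  [/\ measurable_fun setT p, (forall phi, 0 <= p phi) &
      (\int[lebesgue_ffun V]_phi (p phi)%:E)%E = 1%E].

(* phi on A and psi off A *)
Definition splice A phi (psi : {ffun {j | j \notin A} -> R}) : {ffun V -> R} :=
  [ffun j => if insub j is Some u then psi u else phi j].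
Arguments splice : clear implicits.

(* The marginal density of (phi_j)_{j in A}: the sites outside A are integrated
   out. It is evaluated on full configurations, of which it only reads the
   coordinates in A, and it may be +oo.                                       *)
Definition marginal_density p A phi : \bar R :=
  (\int[lebesgue_ffun {j | j \notin A}]_psi
     (p (splice A phi psi))%:E)%E.

(* p(phi_i | (phi_j)_{j in A}), meant for i \notin A. For a probability density
   both marginals are finite almost everywhere; the values of the quotient
   where the denominator is 0 or +oo are conventional.                        *)
Definition conditional_density p (i : V) A phi : \bar R :=
  (marginal_density p (i |: A)%SET phi / marginal_density p A phi)%E.

Definition neighbours (e : rel V) (i : V) : {set V} := [set j | e i j]%SET.

Definition local_markov (e : rel V) p :=
  forall i : V, {ae lebesgue_ffun V, forall phi,
    conditional_density p i [set~ i]%SET phi =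
    conditional_density p i (neighbours e i) phi}.

Definition markov_random_field (e : rel V) p :=
  probability_density p /\ local_markov e p.

Definition partition_function (S : {ffun V -> R} -> R) : \bar R :=
  (\int[lebesgue_ffun V]_phi (expR (- S phi))%:E)%E.

Definition gibbs_density (S : {ffun V -> R} -> R) phi : R :=
  expR (- S phi) / fine (partition_function S).

(* enum_rank picks one ordered pair per unordered edge; for w symmetric on the
   edges the sum does not depend on which one.                                *)
Definition phi4_action (e : rel V) (w : V -> V -> R) (a b : V -> R) phi : R :=
  - (\sum_(ij : V * V | e ij.1 ij.2 && (enum_rank ij.1 < enum_rank ij.2)%N)
       w ij.1 ij.2 * phi ij.1 * phi ij.2)
  + \sum_i a i * phi i ^+ 2 + \sum_i b i * phi i ^+ 4.

End density.
Arguments splice {R V} A phi psi.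

(* The L x L periodic square lattice; 'Z_L is Z/LZ for 1 < L. *)
Definition torus (L : nat) : finType := ('Z_L * 'Z_L)%type.

Definition cyclic_adjacent (L : nat) (x y : 'Z_L) : bool :=
  (y == x + 1) || (x == y + 1).

Definition nearest_neighbour (L : nat) : rel (torus L) :=
  fun i j => ((i.1 == j.1) && cyclic_adjacent i.2 j.2)
          || ((i.2 == j.2) && cyclic_adjacent i.1 j.1).
Arguments nearest_neighbour : clear implicits.

Lemma nearest_neighbour_sym L : symmetric (nearest_neighbour L).
Proof.
move=> i j; rewrite /nearest_neighbour /cyclic_adjacent (eq_sym i.1).
by rewrite (eq_sym i.2) (orbC (j.2 == _)) (orbC (j.1 == _)).
Qed.

Lemma nearest_neighbour_irr L : irreflexive (nearest_neighbour L).
Proof.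
move=> i; rewrite /nearest_neighbour /cyclic_adjacent !eqxx !orbb /=.
rewrite -[X in (X == _) || _]addr0 -[X in _ || (X == _)]addr0.
by rewrite !(inj_eq (addrI _)) eq_sym oner_eq0.
Qed.

(* Main.v *)
(** Fix a site i with neighbourhood N. Since every edge at i ends in N, the action
    splits as S = U + W, where U only reads the sites of {i} ∪ N and W only reads
    the sites other than i; so p = f g with f = exp(-U)/Z and g = exp(-W). Let F
    be the integral of f over the site i and G the integral of g over the sites
    outside {i} ∪ N. As the complement of N is the disjoint union of these two
    domains, Tonelli's theorem gives F G as the marginal on N, and both
    conditional densities reduce to f / F wherever G is finite. Finiteness of G
    almost everywhere is that of the marginal f G of a probability density. *)

From HB Require Import structures.
Require Import Defs.
From mathcomp Require Import all_boot all_order all_algebra.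
From mathcomp Require Import all_classical all_reals all_analysis.
From mathcomp Require Import measurable_realfun.
Import Order.TTheory GRing.Theory Num.Theory.
Local Open Scope classical_set_scope.
Local Open Scope ring_scope.

(** * Boxes and uniqueness of Lebesgue measure *)

Definition ffun_box {R : realType} {I : finType} (B : I -> set R) :
  set {ffun I -> R} := [set f | forall i, B i (f i)].

Definition measurable_boxes (R : realType) (I : finType) :
  set (set {ffun I -> R}) :=
  [set X | exists2 B : I -> set R, (forall i, measurable (B i)) & X = ffun_box B].

Lemma measurable_ffun_box (R : realType) (I : finType) (B : I -> set R) :
  (forall i, measurable (B i)) -> measurable (ffun_box B).
Proof.
move=> mB; rewrite (_ : ffun_box B = \bigcap_(i in [set: I])
    ((fun f : {ffun I -> R} => f i) @^-1` B i)).
  apply: fin_bigcap_measurable => // i _.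
  by rewrite -[X in measurable X]setTI; exact: measurable_ffun_eval.
by apply/seteqP; split=> [f Bf i _|f Bf i]; [exact: Bf | exact: Bf].
Qed.

(** Boxes, unlike the one-coordinate cylinders, are closed under intersection, which makes them a
    usable generating family for measure uniqueness. A cylinder is a box whose other sides are the
    full line. *)
Lemma measurable_boxesE (R : realType) (I : finType) :
  @measurable _ {ffun I -> R} = <<s measurable_boxes R I >>.
Proof.
apply/seteqP; split.
- apply: smallest_sub; first exact: smallest_sigma_algebra.
  move=> _ [i _ [Y mY <-]]; apply: sub_sigma_algebra.
  exists (fun j => if j == i then Y else setT).
    by move=> j; case: ifP.
  rewrite setTI; apply/seteqP; split=> f /= Yf.
    by move=> j; case: ifP => // /eqP ->.
  by have := Yf i; rewrite eqxx.
- apply: smallest_sub; first exact: sigma_algebra_measurable.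
  by move=> _ [B mB ->]; exact: measurable_ffun_box.
Qed.

Lemma lebesgue_ffun_unique (R : realType) (I : finType)
    (m : {measure set {ffun I -> R} -> \bar R}) :
  (forall B : I -> set R, (forall i, measurable (B i)) ->
    m (ffun_box B) = \big[*%E/1%E]_i lebesgue_measure (B i)) ->
  forall A, measurable A -> lebesgue_ffun I A = m A.
Proof.
(* The cubes with sides [[-n, n]] exhaust the space and have finite measure, as uniqueness from a
   generating family closed under intersection requires. *)
move=> mbox; pose c n : I -> set R := fun=> [set` `[- n%:R, n%:R]].
apply: (measure_unique (measurable_boxes R I) (fun n => ffun_box (c n))).
- exact: measurable_boxesE.
- move=> _ _ [B mB ->] [C mC ->]; exists (fun i => B i `&` C i).
    by move=> i; exact: measurableI.
  apply/seteqP; split=> f /=; first by move=> [Bf Cf] i; split.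
  by move=> BCf; split=> i; case: (BCf i).
- by move=> n; exists (c n) => // i; exact: measurable_itv.
- apply/seteqP; split=> // f _.
  (* The l1 norm of [f] bounds every coordinate, so any integer above it gives a cube containing
     [f]. *)
  exists (Num.truncn (\sum_i `|f i|)).+1 => // i.
  rewrite /c /= in_itv/= -ler_norml; apply/ltW.
  apply: le_lt_trans (truncnS_gt _).
  by rewrite (bigD1 i)//= lerDl sumr_ge0.
- move=> _ [B mB ->]; rewrite [RHS]mbox//; exact: lebesgue_ffun_box.
- move=> n; rewrite [ltLHS]lebesgue_ffun_box; last first.
    by move=> i; exact: measurable_itv.
  (* Nonnegativity is carried along because finiteness of a product of extended reals is derived
     from it. *)
  suff /andP[] :
    (0 <= \big[*%E/1%E]_(i : I) lebesgue_measure (c n i) < +oo)%E by [].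
  apply: (@big_ind _ (fun x : \bar R => (0 <= x < +oo)%E)) => [|x y|i _].
  + by rewrite lee01 ltry.
  + move=> /andP[x0 xoo] /andP[y0 yoo]; rewrite mule_ge0//=.
    by rewrite lte_mul_pinfty// ge0_fin_numE.
  + rewrite measure_ge0/= /c lebesgue_measure_itv/=.
    by case: ifP => _; rewrite -?EFinB ltry.
Qed.

(** * Splitting the coordinates into two blocks *)

Lemma measurable_ffun_join (R : realType) (I J K : finType) (s : J + K -> I)
    (g : {ffun J -> R} * {ffun K -> R} -> {ffun I -> R}) :
  (forall i, exists z, s z = i) ->
  (forall z j, g z (s (inl j)) = z.1 j) ->
  (forall z k, g z (s (inr k)) = z.2 k) ->
  measurable_fun setT g.
Proof.
move=> s_surj gl gr; apply: measurable_to_ffun => i.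
have [[j|k] <-] := s_surj i.
- under eq_fun do rewrite gl.
  exact: measurableT_comp (measurable_ffun_eval j) measurable_fst.
- under eq_fun do rewrite gr.
  exact: measurableT_comp (measurable_ffun_eval k) measurable_snd.
Qed.

(** The bijection [s] cuts the index set into two blocks and [g] glues configurations on them; [g]
    is specified only by its coordinates, so any concrete gluing map fits. The preimage of a box
    under [g] is a product of two boxes, so both measures agree on boxes and hence everywhere. *)
Lemma lebesgue_ffun_join (R : realType) (I J K : finType) (s : J + K -> I)
    (g : {ffun J -> R} * {ffun K -> R} -> {ffun I -> R}) :
  injective s -> (forall i, exists z, s z = i) ->
  (forall z j, g z (s (inl j)) = z.1 j) ->
  (forall z k, g z (s (inr k)) = z.2 k) ->
  forall A, measurable A ->
  lebesgue_ffun I A =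
  pushforward (lebesgue_ffun J \x lebesgue_ffun K)%E g A.
Proof.
move=> s_inj s_surj gl gr.
have mg := measurable_ffun_join _ _ _ _ _ _ s_surj gl gr.
have s_bij : bijective s.
  (* Surjectivity is a bare existence; [xchoose] on the decidable equation turns it into an inverse
     map. *)
  have ex i : exists z, s z == i by have [z <-] := s_surj i; exists z.
  have sK : cancel (fun i => xchoose (ex i)) s.
    by move=> i; apply/eqP; exact: (xchooseP (ex i)).
  by exists (fun i => xchoose (ex i)) => // z; apply: s_inj; rewrite sK.
(* Bundling [g] as a measurable function gives its pushforward the structure of a measure. *)
pose gm := isMeasurableFun.Build _ _ _ _ _ mg.
pose g' : {mfun _ >-> _} := HB.pack g gm.
apply: (@lebesgue_ffun_unique R I (pushforward _ g')) => B mB.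
transitivity ((lebesgue_ffun J \x lebesgue_ffun K)%E
    (ffun_box (B \o s \o inl) `*` ffun_box (B \o s \o inr))).
  rewrite /= /pushforward; congr (product_measure1 _ _ _).
  apply/seteqP; split=> -[x y] /=.
    move=> Bg; split=> j /=; first by have := Bg (s (inl j)); rewrite gl.
    by have := Bg (s (inr j)); rewrite gr.
  move=> [Bx By] i; have [[j|k] <-] := s_surj i; rewrite /= ?gl ?gr.
    exact: Bx.
  exact: By.
rewrite product_measure1E; [|by apply: measurable_ffun_box => ?; exact: mB..].
rewrite [X in (X * _)%E]lebesgue_ffun_box; last by move=> j; exact: mB.
rewrite [X in (_ * X)%E]lebesgue_ffun_box; last by move=> j; exact: mB.
by rewrite (reindex s)/=; [rewrite big_sumType | exact: onW_bij].
Qed.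

Lemma integral_lebesgue_ffun_join (R : realType) (I J K : finType)
    (s : J + K -> I) (g : {ffun J -> R} * {ffun K -> R} -> {ffun I -> R})
    (f : {ffun I -> R} -> \bar R) :
  injective s -> (forall i, exists z, s z = i) ->
  (forall z j, g z (s (inl j)) = z.1 j) ->
  (forall z k, g z (s (inr k)) = z.2 k) ->
  measurable_fun [set: {ffun I -> R}] f -> (forall phi, 0 <= f phi)%E ->
  (\int[lebesgue_ffun I]_phi f phi =
   \int[lebesgue_ffun J]_x \int[lebesgue_ffun K]_y f (g (x, y)))%E.
Proof.
move=> s_inj s_surj gl gr mf f0.
have mg := measurable_ffun_join _ _ _ _ _ _ s_surj gl gr.
pose gm := isMeasurableFun.Build _ _ _ _ _ mg.
pose g' : {mfun _ >-> _} := HB.pack g gm.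
rewrite (@eq_measure_integral _ _ _ _ (pushforward
    (lebesgue_ffun J \x lebesgue_ffun K)%E g')); last first.
  by move=> A mA _; exact: (lebesgue_ffun_join _ _ _ _ s g).
rewrite ge0_integral_pushforward//= preimage_setT.
rewrite fubini_tonelli1//; exact: measurableT_comp.
Qed.

(** * Positivity of integrals *)

Lemma lebesgue_ffun_setT (R : realType) (I : finType) :
  lebesgue_ffun I [set: {ffun I -> R}] =
  (\big[*%E/1]_(i : I) lebesgue_measure [set: R])%E.
Proof.
rewrite -(@lebesgue_ffun_box R I (fun=> setT))//; congr (lebesgue_ffun I _).
by apply/seteqP.
Qed.

Lemma lebesgue_ffun_setT_gt0 (R : realType) (I : finType) :
  (0 < lebesgue_ffun I [set: {ffun I -> R}])%E.
Proof.
rewrite lebesgue_ffun_setT.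
apply: (@big_ind _ (fun x : \bar R => (0 < x)%E)) => [|x y|i _].
- exact: lte01.
- exact: mule_gt0.
- by rewrite -set_itvNyy lebesgue_measure_itv/= ltry.
Qed.

(** A vanishing integral would force [f] to be zero almost everywhere; as [f] is zero nowhere, the
    whole space would then be null. *)
Lemma integral_gt0 d (T : measurableType d) (R : realType)
    (mu : {measure set T -> \bar R}) (f : T -> R) :
  (0 < mu setT)%E -> measurable_fun setT f -> (forall x, 0 < f x) ->
  (0 < \int[mu]_x (f x)%:E)%E.
Proof.
move=> mu0 mf f0; rewrite lt0e integral_ge0 ?andbT; last first.
  by move=> x _; rewrite lee_fin ltW.
apply/eqP => If0; have mEf : measurable_fun setT (EFin \o f).
  exact/measurable_EFinP.
have : (\int[mu]_x `|(EFin \o f) x| = 0)%E.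
  rewrite -[RHS]If0; apply: eq_integral => x _ /=.
  by rewrite ger0_norm// ltW.
move/(ae_eq_integral_abs mu measurableT mEf) => [N [mN N0 subN]].
have : (mu setT <= mu N)%E.
  apply: le_measure; rewrite ?inE// => x _; apply: subN => /=.
  by move=> /(_ Logic.I) [] /eqP; rewrite gt_eqF.
by rewrite N0 leNgt mu0.
Qed.

(** * Splicing and marginal densities *)

Lemma splice_in (R : realType) (V : finType) (A : {set V})
    (phi : {ffun V -> R}) psi j : j \in A -> splice A phi psi j = phi j.
Proof. by move=> jA; rewrite ffunE insubF// jA. Qed.

Lemma splice_val (R : realType) (V : finType) (A : {set V})
    (phi : {ffun V -> R}) psi (u : {j | j \notin A}) :
  splice A phi psi (val u) = psi u.
Proof. by rewrite ffunE valK. Qed.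

Lemma eq_splice (R : realType) (V : finType) (A : {set V})
    (phi phi' : {ffun V -> R}) psi :
  {in A, phi =1 phi'} -> splice A phi psi = splice A phi' psi.
Proof.
move=> eqA; apply/ffunP => j; rewrite !ffunE; case: insubP => // jA.
by apply: eqA; rewrite -[_ \in _]negbK.
Qed.

Lemma measurable_splice (R : realType) (V : finType) (A : {set V})
    (phi : {ffun V -> R}) : measurable_fun setT (splice A phi).
Proof.
apply: measurable_to_ffun => j.
rewrite (_ : (fun psi => splice A phi psi j) = (fun psi =>
    if insub j is Some u then psi u else phi j)).
  by case: insub => [u|]; [exact: measurable_ffun_eval | exact: measurable_cst].
by apply/funext => psi; rewrite ffunE.
Qed.

Lemma measurable_comp_splice (R : realType) (V : finType)
    (p : {ffun V -> R} -> R) (A : {set V}) phi :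
  measurable_fun setT p ->
  measurable_fun setT (fun psi => (p (splice A phi psi))%:E).
Proof.
move=> mp; apply/measurable_EFinP.
exact: measurableT_comp mp (measurable_splice _ _ _ _).
Qed.

Lemma marginal_density_ge0 (R : realType) (V : finType)
    (p : {ffun V -> R} -> R) (A : {set V}) phi :
  (forall phi, 0 <= p phi) -> (0 <= marginal_density p A phi)%E.
Proof. by move=> p0; apply: integral_ge0 => psi _; rewrite lee_fin. Qed.

Lemma marginal_density_gt0 (R : realType) (V : finType)
    (p : {ffun V -> R} -> R) (A : {set V}) phi :
  measurable_fun setT p -> (forall phi, 0 < p phi) ->
  (0 < marginal_density p A phi)%E.
Proof.
move=> mp p0; apply: integral_gt0 => //; first exact: lebesgue_ffun_setT_gt0.
exact: measurableT_comp mp (measurable_splice _ _ _ _).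
Qed.

Lemma marginal_density_setT (R : realType) (V : finType)
    (p : {ffun V -> R} -> R) phi :
  marginal_density p [set: V]%SET phi = (p phi)%:E.
Proof.
rewrite /marginal_density (eq_integral (fun=> (p phi)%:E)); last first.
  move=> psi _; congr (p _)%:E; apply/ffunP => j.
  by rewrite splice_in// inE.
(* No site is left to integrate: the domain is a single point, whose mass is the empty product 1. *)
rewrite integral_cst//.
rewrite [X in (_ * X)%E]lebesgue_ffun_setT big_pred0 ?mule1// => -[j jT].
by rewrite inE in jT.
Qed.

(** * Marginals of product densities and their finiteness *)

Definition depends_on {R : realType} {V : finType} (A : {set V})
  (f : {ffun V -> R} -> R) :=
  forall phi psi : {ffun V -> R}, {in A, phi =1 psi} -> f phi = f psi.

Lemma depends_on_splice (R : realType) (V : finType) (A : {set V})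
    (f : {ffun V -> R} -> R) phi psi :
  depends_on A f -> f (splice A phi psi) = f phi.
Proof. by apply=> j jA; exact: splice_in. Qed.

Lemma marginal_density_mull (R : realType) (V : finType) (A : {set V})
    (f g : {ffun V -> R} -> R) phi :
  depends_on A f -> (forall phi, 0 <= f phi) -> (forall phi, 0 <= g phi) ->
  measurable_fun setT g ->
  marginal_density (f \* g) A phi = ((f phi)%:E * marginal_density g A phi)%E.
Proof.
move=> fA f0 g0 mg; rewrite -ge0_integralZl//; last 3 first.
- exact: measurable_comp_splice.
- by move=> psi _; rewrite lee_fin.
- by rewrite lee_fin.
by apply: eq_integral => psi _ /=; rewrite depends_on_splice.
Qed.

(* The complements of A and B partition the complement of A :&: B. *)
Lemma marginal_density_setI (R : realType) (V : finType) (A B : {set V})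
    (f g : {ffun V -> R} -> R) phi :
  (A :|: B = [set: V])%SET -> depends_on A f -> depends_on B g ->
  measurable_fun setT f -> measurable_fun setT g ->
  (forall phi, 0 <= f phi) -> (forall phi, 0 <= g phi) ->
  marginal_density (f \* g) (A :&: B)%SET phi =
  (marginal_density f B phi * marginal_density g A phi)%E.
Proof.
move=> ABT fA gB mf mg f0 g0.
have AB j : (j \in A) || (j \in B).
  by have /setP/(_ j) := ABT; rewrite !inE.
have sBl j : j \notin B -> j \notin (A :&: B)%SET.
  by rewrite inE negb_and => ->; rewrite orbT.
have sAr j : j \notin A -> j \notin (A :&: B)%SET.
  by rewrite inE negb_and => ->.
pose s (z : {j | j \notin B} + {j | j \notin A}) :
    {j | j \notin (A :&: B)%SET} :=
  match z with
  | inl u => exist _ (val u) (sBl _ (valP u))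
  | inr u => exist _ (val u) (sAr _ (valP u))
  end.
(* [h] overwrites [phi] first outside [B], then outside [A]; [k] reads the result off the complement
   of [A :&: B]. *)
pose h (z : {ffun {j | j \notin B} -> R} * {ffun {j | j \notin A} -> R}) :=
  splice A (splice B phi z.1) z.2.
pose k z : {ffun {j | j \notin (A :&: B)%SET} -> R} :=
  [ffun u => h z (val u)].
have kl z u : k z (s (inl u)) = z.1 u.
  rewrite ffunE /h splice_in ?splice_val//=.
  by move: (AB (val u)); rewrite (negbTE (valP u)) orbF.
have kr z u : k z (s (inr u)) = z.2 u.
  by rewrite ffunE /h splice_val.
(* A site coming from both summands would lie outside both [A] and [B], against the cover. *)
have s_inj : injective s.
  move=> [x|x] [y|y] /(congr1 val) /= xy; first 1 [congr inl; exact: val_inj].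
  - have := AB (sval x).
    by rewrite [X in _ || X](negbTE (valP x)) orbF xy (negbTE (valP y)).
  - have := AB (sval x).
    by rewrite [X in X || _](negbTE (valP x)) xy (negbTE (valP y)).
  - congr inr; exact: val_inj.
have s_surj u : exists z, s z = u.
  case: u => j jAB; have [jA|jA] := boolP (j \in A); last first.
    by exists (inr (exist _ j jA)); exact: val_inj.
  have jB : j \notin B by move: jAB; rewrite inE jA.
  by exists (inl (exist _ j jB)); exact: val_inj.
have spl z : splice (A :&: B)%SET phi (k z) = h z.
  apply/ffunP => j; rewrite ffunE; case: insubP => [u _ uj|].
    by rewrite ffunE uj.
  rewrite negbK inE => /andP[jA jB].
  by rewrite /h !splice_in.
rewrite {1}/marginal_density (integral_lebesgue_ffun_join _ _ _ _ s k)//.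
- rewrite -ge0_integralZr//; last 3 first.
  + exact: measurable_comp_splice.
  + by move=> psi _; rewrite lee_fin.
  + exact: marginal_density_ge0.
  apply: eq_integral => x _.
  rewrite -ge0_integralZl//; last 3 first.
  + exact: measurable_comp_splice.
  + by move=> psi _; rewrite lee_fin.
  + by rewrite lee_fin.
  (* At [h (x, y)], [f] does not see the outer splice and [g] does not see the inner one, so the
     integrand separates. *)
  apply: eq_integral => y _; rewrite spl /= -EFinM; congr (_ * _)%:E.
    by exact: depends_on_splice.
  apply: gB => j jB; rewrite /h [LHS]ffunE [RHS]ffunE.
  by case: insub => //; rewrite splice_in.
- by apply: measurable_comp_splice; exact: measurable_funM.
- by move=> psi; rewrite lee_fin mulr_ge0.
Qed.

(** By Tonelli the marginal, viewed as a function on the configurations over [A], has integral 1, so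
    it is infinite only on a null set there. The cylinder over that null set is null in the full
    space. *)
Lemma marginal_density_ae_lty (R : realType) (V : finType)
    (p : {ffun V -> R} -> R) (A : {set V}) :
  probability_density p ->
  {ae lebesgue_ffun V, forall phi, marginal_density p A phi < +oo}%E.
Proof.
move=> [mp p0 p1].
pose s (z : {j | j \in A} + {j | j \notin A}) : V :=
  match z with inl u => val u | inr u => val u end.
(* The default 0 outside [A] is harmless: the splice in [k] overwrites those coordinates. *)
pose ext (x : {ffun {j | j \in A} -> R}) : {ffun V -> R} :=
  [ffun j => if insub j is Some u then x u else 0].
pose k (z : {ffun {j | j \in A} -> R} * {ffun {j | j \notin A} -> R}) :=
  splice A (ext z.1) z.2.
have extE x (u : {j | j \in A}) : ext x (val u) = x u by rewrite ffunE valK.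
have kl z u : k z (s (inl u)) = z.1 u.
  by rewrite /k splice_in/= ?extE//; exact: valP.
have kr z u : k z (s (inr u)) = z.2 u by rewrite /k splice_val.
have s_inj : injective s.
  move=> [x|x] [y|y] /= xy; first 1 [congr inl; exact: val_inj].
  - by have := valP y; rewrite -[X in X \notin _]xy (valP x).
  - by have := valP x; rewrite [X in X \notin _]xy (valP y).
  - congr inr; exact: val_inj.
have s_surj j : exists z, s z = j.
  have [jA|jA] := boolP (j \in A); first by exists (inl (exist _ j jA)).
  by exists (inr (exist _ j jA)).
have mk := measurable_ffun_join R _ _ _ s k s_surj kl kr.
have mEp : measurable_fun [set: {ffun V -> R}] (EFin \o p).
  exact/measurable_EFinP.
pose m x := marginal_density p A (ext x).
have mm : measurable_fun setT m.
  have mpk : measurable_fun setT ((EFin \o p) \o k).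
    exact: measurableT_comp mEp mk.
  apply: (measurable_fun_fubini_tonelli_F (m2 := lebesgue_ffun _) _ mpk) => z.
  by rewrite lee_fin.
have int1 : (\int[lebesgue_ffun {j | j \in A}]_x m x = 1)%E.
  by rewrite -p1 (integral_lebesgue_ffun_join _ _ _ _ s k).
have m0 x : (0 <= m x)%E by exact: marginal_density_ge0.
have : (lebesgue_ffun {j | j \in A}).-integrable setT m.
  apply/integrableP; split => //.
  under eq_integral do rewrite gee0_abs//.
  by rewrite int1 ltry.
move=> /(integrable_ae measurableT) [N [mN N0 subN]].
pose r (phi : {ffun V -> R}) : {ffun {j | j \in A} -> R} :=
  [ffun u => phi (val u)].
have mr : measurable_fun setT r.
  apply: measurable_to_ffun => u; under eq_fun do rewrite ffunE.
  exact: measurable_ffun_eval.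
(* Seen through the gluing map [k], this set is [N] times the whole second factor, of measure
   zero. *)
exists (r @^-1` N); split.
- by rewrite -[X in measurable X]setTI; exact: mr.
- rewrite [LHS](lebesgue_ffun_join _ _ _ _ s k)//; last first.
    by rewrite -[X in measurable X]setTI; exact: mr.
  rewrite /pushforward (_ : _ @^-1` _ = N `*` setT).
    by rewrite product_measure1E// N0 mul0e.
  have rk z : r (k z) = z.1 by apply/ffunP => u; rewrite ffunE (kl z).
  by apply/seteqP; split=> -[x y] /=; rewrite /preimage/= rk//; case.
- move=> phi /= phioo; apply: subN => /= /(_ Logic.I).
  suff -> : m (r phi) = marginal_density p A phi.
    by move=> mfin; apply: phioo; rewrite ltey_eq mfin.
  apply: eq_integral => psi _; congr (p _)%:E; apply: eq_splice => j jA.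
  by rewrite -[j in LHS](_ : val (exist _ j jA) = j)// extE ffunE.
Qed.

(** * Conditional densities of a product density *)

Lemma conditional_density_factor (R : realType) (V : finType) (i : V)
    (A : {set V}) (f g : {ffun V -> R} -> R) :
  i \notin A -> depends_on (i |: A)%SET f -> depends_on [set~ i]%SET g ->
  measurable_fun setT f -> measurable_fun setT g ->
  (forall phi, 0 < f phi) -> (forall phi, 0 < g phi) ->
  probability_density (f \* g) ->
  {ae lebesgue_ffun V, forall phi,
    conditional_density (f \* g) i [set~ i]%SET phi =
    conditional_density (f \* g) i A phi}.
Proof.
move=> iA fA gB mf mg f0 g0 pfg.
have f0' phi : 0 <= f phi by exact: ltW.
have g0' phi : 0 <= g phi by exact: ltW.
have cover : ((i |: A) :|: [set~ i])%SET = [set: V]%SET.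
  by apply/setP => j; rewrite !inE orbAC orbN.
have inter : ((i |: A) :&: [set~ i])%SET = A.
  apply/setP => j; rewrite !inE; have [->|_] := eqVneq j i.
    by rewrite andbF (negbTE iA).
  by rewrite andbT.
apply: filterS (marginal_density_ae_lty _ _ _ (i |: A)%SET pfg) => phi.
(* The third occurrence of [A] is the denominator of the right-hand quotient; written as an
   intersection, its marginal splits into [F] times [G]. *)
rewrite /conditional_density finset.setUCr marginal_density_setT -{3}inter.
rewrite marginal_density_setI// marginal_density_mull//.
(* The factors are swapped so that [g], which does not read [i], can be pulled out of the marginal
   on [[set~ i]]. *)
rewrite (_ : f \* g = g \* f) in pfg *; last first.
  by apply/funext => x /=; rewrite mulrC.
rewrite marginal_density_mull//.
have F0 := marginal_density_gt0 _ _ _ [set~ i]%SET phi mf f0.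
have G0 := marginal_density_gt0 _ _ _ (i |: A)%SET phi mg g0.
move: (marginal_density f _ phi) (marginal_density g _ phi) F0 G0 => F G.
have fg0 : f phi != 0 by rewrite gt_eqF.
have gg0 : g phi != 0 by rewrite gt_eqF.
(* An infinite [G] would make the marginal [f G] infinite, since [f] is positive; this is excluded
   at [phi]. *)
case: G => [G| |]//; last by rewrite gt0_muley ?lte_fin.
case: F => [F| |]//; rewrite ?lte_fin => F0 G0 _.
- rewrite -!EFinM !inver !mulf_eq0 (gt_eqF F0) (gt_eqF G0) (negbTE gg0)/=.
  rewrite -!EFinM; congr EFin; rewrite !invfM.
  rewrite (mulrC (g phi)) -!mulrA; congr (_ * _).
  by rewrite (mulrCA G) divff ?gt_eqF// mulrA divff// mul1r mulr1.
(* F = +oo is possible; both quotients are then 0. *)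
- by rewrite gt0_muley ?lte_fin// gt0_mulye ?lte_fin// invey !mule0.
Qed.

(** * Gibbs densities *)

Lemma measurable_expRN (R : realType) (V : finType) (S : {ffun V -> R} -> R) :
  measurable_fun setT S -> measurable_fun setT (fun phi => expR (- S phi)).
Proof.
move=> mS; apply: measurableT_comp; first exact: measurable_expR.
exact: measurable_funN.
Qed.

Lemma fine_partition_function_gt0 (R : realType) (V : finType)
    (S : {ffun V -> R} -> R) :
  measurable_fun setT S -> (partition_function S < +oo)%E ->
  0 < fine (partition_function S).
Proof.
move=> mS Zoo; apply: fine_gt0; rewrite Zoo andbT.
apply: integral_gt0; first exact: lebesgue_ffun_setT_gt0.
- exact: measurable_expRN.
- by move=> phi; exact: expR_gt0.
Qed.

Lemma gibbs_probability_density (R : realType) (V : finType)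
    (S : {ffun V -> R} -> R) :
  measurable_fun setT S -> (partition_function S < +oo)%E ->
  probability_density (gibbs_density S).
Proof.
move=> mS Zoo; have Z0 := fine_partition_function_gt0 _ _ _ mS Zoo.
have mE : measurable_fun setT (fun phi => expR (- S phi)).
  exact: measurable_expRN.
have Zfin : partition_function S \is a fin_num.
  by rewrite ge0_fin_numE// integral_ge0// => phi _; rewrite lee_fin expR_ge0.
split.
- exact: measurable_funM.
- by move=> phi; rewrite divr_ge0 ?expR_ge0 ?ltW.
- rewrite /gibbs_density; under eq_integral do rewrite EFinM.
  rewrite ge0_integralZr//.
  + by rewrite -/(partition_function S) -{1}(fineK Zfin) -EFinM divff ?gt_eqF.
  + exact/measurable_EFinP.
  + by rewrite lee_fin invr_ge0 ltW.
Qed.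

Lemma gibbs_conditional_density (R : realType) (V : finType) (i : V)
    (A : {set V}) (S U W : {ffun V -> R} -> R) :
  i \notin A -> S = U \+ W ->
  depends_on (i |: A)%SET U -> depends_on [set~ i]%SET W ->
  measurable_fun setT U -> measurable_fun setT W ->
  (partition_function S < +oo)%E ->
  {ae lebesgue_ffun V, forall phi,
    conditional_density (gibbs_density S) i [set~ i]%SET phi =
    conditional_density (gibbs_density S) i A phi}.
Proof.
move=> iA SUW UA WB mU mW Zoo.
have mS : measurable_fun setT S by rewrite SUW; exact: measurable_funD.
have Z0 := fine_partition_function_gt0 _ _ _ mS Zoo.
pose f phi := expR (- U phi) / fine (partition_function S).
pose g phi := expR (- W phi).
have gibbsE : gibbs_density S = f \* g.
  apply/funext => phi; rewrite /gibbs_density /f /g {1}SUW /=.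
  by rewrite opprD expRD mulrAC.
have := gibbs_probability_density _ _ _ mS Zoo; rewrite gibbsE => pfg.
apply: conditional_density_factor => //.
- by move=> phi psi /UA Ueq; rewrite /f Ueq.
- by move=> phi psi /WB Weq; rewrite /g Weq.
- by apply: measurable_funM => //; exact: measurable_expRN.
- exact: measurable_expRN.
- by move=> phi; rewrite divr_gt0 ?expR_gt0.
- by move=> phi; exact: expR_gt0.
Qed.

(** * The phi^4 action and its splitting at a site *)

(** The predicates [P] and [Q] let one statement serve the full action and both of its pieces. *)
Lemma measurable_partial_action (R : realType) (V : finType)
    (P : pred (V * V)) (Q : pred V) (w : V -> V -> R) (a b : V -> R) :
  measurable_fun setT (fun phi : {ffun V -> R} =>
    - (\sum_(ij | P ij) w ij.1 ij.2 * phi ij.1 * phi ij.2)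
    + \sum_(i | Q i) a i * phi i ^+ 2 + \sum_(i | Q i) b i * phi i ^+ 4).
Proof.
have ev i := @measurable_ffun_eval _ R V i.
have msite (c : V -> R) n : measurable_fun setT
    (fun phi : {ffun V -> R} => \sum_(i | Q i) c i * phi i ^+ n).
  under eq_fun do rewrite big_mkcond/=.
  apply: measurable_sum => i; case: (Q i); last exact: measurable_cst.
  by apply: measurable_funM => //; exact: measurable_funX.
apply: measurable_funD; last exact: msite.
apply: measurable_funD; last exact: msite.
apply: measurable_funN; under eq_fun do rewrite big_mkcond/=.
apply: measurable_sum => ij; case: (P ij); last exact: measurable_cst.
by apply: measurable_funM => //; exact: measurable_funM.
Qed.

(** Symmetry of [e] makes the other end of an edge at [i] a neighbour of [i], whichever end
    [enum_rank] puts first; irreflexivity keeps [i] out of its own neighbourhood. *)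
Lemma phi4_markov_random_field (R : realType) (V : finType) (e : rel V)
    (w : V -> V -> R) (a b : V -> R) :
  symmetric e -> irreflexive e ->
  (partition_function (phi4_action e w a b) < +oo)%E ->
  markov_random_field e (gibbs_density (phi4_action e w a b)).
Proof.
move=> e_sym e_irr Zoo; split.
  apply: gibbs_probability_density => //; exact: measurable_partial_action.
move=> i; pose at_i (ij : V * V) := (ij.1 == i) || (ij.2 == i).
pose E (ij : V * V) := e ij.1 ij.2 && (enum_rank ij.1 < enum_rank ij.2)%N.
pose part (P : pred (V * V)) (Q : pred V) (phi : {ffun V -> R}) : R :=
    - (\sum_(ij | P ij) w ij.1 ij.2 * phi ij.1 * phi ij.2)
    + \sum_(i | Q i) a i * phi i ^+ 2 + \sum_(i | Q i) b i * phi i ^+ 4.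
have part_dep (A : {set V}) (P : pred (V * V)) (Q : pred V) :
    (forall ij, P ij -> (ij.1 \in A) && (ij.2 \in A)) ->
    (forall j, Q j -> j \in A) -> depends_on A (part P Q).
  move=> PA QA phi psi eqA; rewrite /part.
  congr (- _ + _ + _); apply: eq_bigr => j.
  - by move=> /PA/andP[j1 j2]; rewrite !eqA.
  - by move=> /QA jA; rewrite eqA.
  - by move=> /QA jA; rewrite eqA.
(* [U] collects the edges touching [i] and the site terms of [i]; [W] collects everything else. *)
apply: (@gibbs_conditional_density _ _ _ _ _
  (part [pred ij | E ij && at_i ij] (pred1 i))
  (part [pred ij | E ij && ~~ at_i ij] (predC1 i))) => //.
- by rewrite inE e_irr.
- apply/funext => phi; rewrite /phi4_action /part /=.
  (* The edge sum splits by [at_i], and each site sum splits off its term at [i]. *)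
  rewrite (bigID at_i)/= (bigD1 i)//= (bigD1 (F := fun i => b i * _) i)//=.
  by rewrite !big_pred1_eq opprD (addrACA (- _)) [LHS]addrACA.
- apply: part_dep => [[j k] /andP[/andP[/= ejk _]]|j /eqP ->].
    rewrite /at_i/= => /orP[]/eqP Ei; move: ejk; rewrite Ei !inE eqxx/= => ejk.
      by rewrite ejk orbT.
    by rewrite e_sym ejk orbT.
  by rewrite !inE eqxx.
- apply: part_dep => [[j k] /andP[_]|j]; rewrite ?inE//.
  by rewrite /at_i/= negb_or.
- exact: measurable_partial_action.
- exact: measurable_partial_action.
Qed.

Theorem mainTheorem1 (R : realType) (L : nat) (hL : (3 <= L)%N)
    (w : torus L -> torus L -> R) (a b : torus L -> R)
    (w_sym : forall i j, nearest_neighbour L i j -> w i j = w j i)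
    (Z_fin : (partition_function
                (phi4_action (nearest_neighbour L) w a b) < +oo)%E) :
  markov_random_field (nearest_neighbour L)
    (gibbs_density (phi4_action (nearest_neighbour L) w a b)).
Proof.
apply: phi4_markov_random_field Z_fin; first exact: nearest_neighbour_sym.
exact: nearest_neighbour_irr.
Qed.
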